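(* Let $n\ge 1$ and let $\phi=B^{-1}\circ A:\mathfrak{S}_n\to\mathfrak{S}_n$. Then: (1) For every $\sigma\in\mathfrak{S}_n$, $$(\mathsf{Inv}(\sigma),\mathsf{Rmil}(\sigma),\mathsf{Lmap}(\sigma),\mathsf{Lmil}(\sigma))=(\mathsf{Sor}(\phi(\sigma)),\mathsf{Cyc}(\phi(\sigma)),\mathsf{Lmap}(\phi(\sigma)),\mathsf{Lmic}_1(\phi(\sigma))).$$ (2) The quadruples of statistics $(\mathsf{inv},\mathsf{rmin},\mathsf{lmax},\mathsf{lmin})$ and $(\mathsf{sor},\mathsf{cyc},\mathsf{lmax},\mathsf{lmic}_1)$ have the same joint distribution over $\mathfrak{S}_n$, and $$\sum_{\sigma\in\mathfrak{S}_n}q^{\mathsf{inv}(\sigma)}x^{\mathsf{rmin}(\sigma)}y^{\mathsf{lmin}(\sigma)}=\sum_{\sigma\in\mathfrak{S}_n}q^{\mathsf{sor}(\sigma)}x^{\mathsf{cyc}(\sigma)}y^{\mathsf{lmic}_1(\sigma)}=xy\prod_{r=2}^{n}\bigl(x+[r]_q+yq^{r-1}-1-q^{r-1}\bigr),$$ where $[r]_q=1+q+\dots+q^{r-1}$.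
   Context: $\mathfrak{S}_n$ is the symmetric group on $[n]=\{1,\dots,n\}$; a permutation is written in one-line notation $\sigma=\sigma_1\cdots\sigma_n$ with $\sigma_i=\sigma(i)$, and products of permutations are composed as functions from right to left. Lehmer code: $\mathsf{Leh}(\sigma)=(\ell_1,\dots,\ell_n)$ with $\ell_i=\#\{j:1\le j\le i,\ \sigma_j\le\sigma_i\}$; it is a bijection from $\mathfrak{S}_n$ onto $\mathcal{L}_n=\{(\ell_1,\dots,\ell_n):1\le \ell_i\le i\}$. The $A$-code is $A(\sigma)=\mathsf{Leh}(\sigma^{-1})$. The $B$-code is $B(\sigma)=(b_1,\dots,b_n)$ where $b_i=\sigma^{-k_i}(i)$ and $k_i\ge1$ is the smallest integer with $\sigma^{-k_i}(i)\le i$; $B:\mathfrak{S}_n\to\mathcal{L}_n$ is a bijection. For $(\ell_1,\dots,\ell_n)\in\mathcal{L}_n$ let $O((\ell_1,\dots,\ell_n))=\{i:\ell_i=1\}$. Induced set $\langle(\ell_1,\dots,\ell_n)\rangle$ of $(\ell_1,\dots,\ell_n)\in\mathcal{L}_n$: start with $S=[n]$, $U=\emptyset$; for $i=n,n-1,\dots,1$: let $\ell_i'$ be the $\ell_i$-th smallest element of $S$, add to $U$ all ordered pairs $(\ell_i',j)$ with $j\in S$, $j>\ell_i'$, then delete $\ell_i'$ from $S$. The final $U$ is the induced set. Set-valued statistics: $\mathsf{Inv}(\sigma)=\{(i,j):i<j,\ \sigma_i>\sigma_j\}$; $\mathsf{Sor}(\sigma)=\langle B(\sigma)\rangle$; $\mathsf{Rmil}(\sigma)=\{\sigma_i:\sigma_i<\sigma_j\text{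 for all }j>i\}$; $\mathsf{Lmap}(\sigma)=\{i:\sigma_i>\sigma_j\text{ for all }j<i\}$; $\mathsf{Lmil}(\sigma)=\{\sigma_i:\sigma_i<\sigma_j\text{ for all }j<i\}$; $\mathsf{Cyc}(\sigma)$ = the set of smallest elements of the cycles of $\sigma$; $\mathsf{Lmic}_1(\sigma)=O(B(\sigma))$. Ordinary statistics: $\mathsf{inv}=\#\mathsf{Inv}$, $\mathsf{rmin}=\#\mathsf{Rmil}$, $\mathsf{lmax}=\#\mathsf{Lmap}$, $\mathsf{lmin}=\#\mathsf{Lmil}$, $\mathsf{cyc}=\#\mathsf{Cyc}$ (number of cycles), $\mathsf{lmic}_1=\#\mathsf{Lmic}_1$. The sorting index: write $\sigma$ uniquely as a product of transpositions $\sigma=(i_1\,j_1)(i_2\,j_2)\cdots(i_k\,j_k)$ with $j_1<j_2<\dots<j_k$ and $i_r<j_r$ for all $r$; then $\mathsf{sor}(\sigma)=\sum_{r=1}^k(j_r-i_r)$. *)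

(* Defs.v *)
From HB Require Import structures.
From mathcomp Require Import all_boot all_order all_algebra all_fingroup.

Set Implicit Arguments.
Unset Strict Implicit.
Unset Printing Implicit Defensive.

(* The element i : 'I_n stands for i + 1 in [n] = {1, ..., n}.  Code entries  *)
(* are kept 1-based, hence the successors below: (l_1, ..., l_n) is encoded   *)
(* by the function sending i : 'I_n to l_(i+1).                               *)
Definition code (n : nat) := {ffun 'I_n -> nat}.

Definition is_code n (l : code n) : bool := [forall i : 'I_n, 1 <= l i <= i.+1].

Definition Leh n (s : 'S_n) : code n :=
  [ffun i : 'I_n => #|[set j : 'I_n | (j <= i) && (s j <= s i)]|].

Definition Acode n (s : 'S_n) : code n := Leh (s^-1)%g.

Lemma Bexp_exists n (s : 'S_n) (i : 'I_n) :
  exists k, (1 <= k) && ((s ^- k)%g i <= i).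
Proof.
by exists #[s]%g; rewrite order_gt0 expg_order invg1 perm1 leqnn.
Qed.

Definition Bexp n (s : 'S_n) (i : 'I_n) : nat := ex_minn (Bexp_exists s i).

Definition Bcode n (s : 'S_n) : code n := [ffun i : 'I_n => ((s ^- Bexp s i)%g i).+1].

Definition ones n (l : code n) : {set 'I_n} := [set i | l i == 1].

(* k-th smallest element of S (k >= 1); enum lists S increasingly.  The       *)
(* default x0 is only returned when k > #|S|.                                 *)
Definition kth_smallest n (x0 : 'I_n) (S : {set 'I_n}) (k : nat) : 'I_n :=
  nth x0 (enum S) k.-1.

Definition induced_step n (l : code n) (i : 'I_n)
    (SU : {set 'I_n} * {set 'I_n * 'I_n}) : {set 'I_n} * {set 'I_n * 'I_n} :=
  let l' := kth_smallest i SU.1 (l i) in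
  (SU.1 :\ l', SU.2 :|: [set (l', j) | j in SU.1 & l' < j]).

(* foldr handles the last index first, so i runs from n down to 1. *)
Definition induced n (l : code n) : {set 'I_n * 'I_n} :=
  (foldr (induced_step l) (setT, set0) (enum 'I_n)).2.

Definition Inv n (s : 'S_n) : {set 'I_n * 'I_n} :=
  [set p : 'I_n * 'I_n | (p.1 < p.2) && (s p.2 < s p.1)].
Definition Sor n (s : 'S_n) : {set 'I_n * 'I_n} := induced (Bcode s).
Definition Rmil n (s : 'S_n) : {set 'I_n} :=
  [set s i | i : 'I_n & [forall j : 'I_n, (i < j) ==> (s i < s j)]].
Definition Lmap n (s : 'S_n) : {set 'I_n} :=
  [set i : 'I_n | [forall j : 'I_n, (j < i) ==> (s j < s i)]].
Definition Lmil n (s : 'S_n) : {set 'I_n} :=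
  [set s i | i : 'I_n & [forall j : 'I_n, (j < i) ==> (s i < s j)]].
Definition Cyc n (s : 'S_n) : {set 'I_n} :=
  [set i : 'I_n | [forall j in porbit s i, i <= j]].
Definition Lmic1 n (s : 'S_n) : {set 'I_n} := ones (Bcode s).

Definition inv_stat n (s : 'S_n) : nat := #|Inv s|.
Definition rmin n (s : 'S_n) : nat := #|Rmil s|.
Definition lmax n (s : 'S_n) : nat := #|Lmap s|.
Definition lmin n (s : 'S_n) : nat := #|Lmil s|.
Definition cyc n (s : 'S_n) : nat := #|Cyc s|.
Definition lmic1 n (s : 'S_n) : nat := #|Lmic1 s|.

(* The product (i_1 j_1)(i_2 j_2)...(i_k j_k), composed from right to left;   *)
(* the library product is the opposite one, (s * t) x = t (s x).              *)
Definition tperm_prod n (d : seq ('I_n * 'I_n)) : 'S_n :=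
  foldr (fun p t => (t * tperm p.1 p.2)%g) 1%g d.

Definition sorting_decomp n (s : 'S_n) (d : seq ('I_n * 'I_n)) : bool :=
  [&& sorted (fun p q : 'I_n * 'I_n => p.2 < q.2) d,
      all (fun p : 'I_n * 'I_n => p.1 < p.2) d
    & s == tperm_prod d].

Lemma tperm_prod_rcons n (d : seq ('I_n * 'I_n)) p :
  tperm_prod (rcons d p) = (tperm p.1 p.2 * tperm_prod d)%g.
Proof.
by elim: d => [|q d IHd] /=; [rewrite mul1g mulg1 | rewrite IHd mulgA].
Qed.

Lemma sorted_rcons_snd n (d : seq ('I_n * 'I_n)) p :
  sorted (fun p q : 'I_n * 'I_n => p.2 < q.2) (rcons d p) =
  sorted (fun p q : 'I_n * 'I_n => p.2 < q.2) d && all (fun q : 'I_n * 'I_n => q.2 < p.2) d.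
Proof.
have tr : transitive (fun p q : 'I_n * 'I_n => p.2 < q.2).
  by move=> b a c; apply: ltn_trans.
by rewrite !(sorted_pairwise tr) pairwise_rcons andbC.
Qed.

Lemma sorting_decomp_exists n (s : 'S_n) : exists d, sorting_decomp s d.
Proof.
suff H m : forall s : 'S_n, (forall z : 'I_n, m <= z -> s z = z) ->
    exists2 d, sorting_decomp s d & all (fun p : 'I_n * 'I_n => p.2 < m) d.
  have [|d Hd _] := H n s; last by exists d.
  by move=> z; rewrite leqNgt ltn_ord.
elim: m => [|m IHm] {}s sfix.
  exists [::]; rewrite /sorting_decomp //=.
  by apply/eqP/permP => z; rewrite perm1 sfix.
have wk d : all (fun p : 'I_n * 'I_n => p.2 < m) d ->
    all (fun p : 'I_n * 'I_n => p.2 < m.+1) d.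
  by apply: sub_all => p; apply: ltnW.
have [le_nm | lt_mn] := leqP n m.
  have [|d Hd Hm] := IHm s.
    by move=> z /(leq_trans le_nm); rewrite leqNgt ltn_ord.
  by exists d => //; apply: wk.
pose M := Ordinal lt_mn; pose a := (s^-1)%g M.
have sa : s a = M by rewrite /a permKV.
have le_aM : a <= m.
  rewrite leqNgt; apply/negP => lt_ma.
  by move: (lt_ma); rewrite -{1}(sfix a lt_ma) sa ltnn.
have [|d /and3P[srt lts /eqP def_s] Hm] := IHm (tperm a M * s)%g.
  move=> z le_mz; rewrite permM; have [->|neq_zM] := eqVneq z M.
    by rewrite tpermR.
  have lt_mz : m < z.
    by rewrite ltn_neqAle le_mz andbT; apply: contra neq_zM => /eqP ?; apply/eqP/val_inj.
  rewrite tpermD ?sfix //; last by rewrite eq_sym.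
  by apply: contraTneq lt_mz => <-; rewrite -leqNgt.
have [eq_aM|neq_aM] := eqVneq a M.
  exists d; last exact: wk.
  rewrite /sorting_decomp srt lts -def_s eq_aM /=; apply/eqP/permP => z.
  by rewrite permM tperm1 perm1.
exists (rcons d (a, M)); last by rewrite all_rcons /= ltnSn wk.
rewrite /sorting_decomp sorted_rcons_snd srt Hm all_rcons lts tperm_prod_rcons /=.
rewrite -def_s mulgA tperm2 mul1g eqxx !andbT.
by rewrite ltn_neqAle le_aM andbT; apply: contra neq_aM => /eqP ?; apply/eqP/val_inj.
Qed.

(* The choice is immaterial: see sorting_decomp_uniq. *)
Definition sor n (s : 'S_n) : nat :=
  \sum_(p <- xchoose (sorting_decomp_exists s)) (p.2 - p.1).

(* first_return t i x y: starting from x, y is the first of t x, t (t x), ... *)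
(* that is at most i.                                                         *)
Inductive first_return n (t : 'S_n) (i : 'I_n) : 'I_n -> 'I_n -> Prop :=
| FirstReturnHit x : t x <= i -> first_return t i x (t x)
| FirstReturnStep x y :
    i < t x -> first_return t i (t x) y -> first_return t i x y.

Lemma first_return_hit n (t : 'S_n) (i x y : 'I_n) :
  t x = y -> y <= i -> first_return t i x y.
Proof. by move<-; apply: FirstReturnHit. Qed.

Lemma first_returnP n (t : 'S_n) i x y : first_return t i x y ->
  exists k, [/\ 0 < k, (t ^+ k)%g x = y, y <= i &
    forall j, 0 < j < k -> i < (t ^+ j)%g x].
Proof.
elim=> {x y} [x le_i | x y lt_i _ [k [k0 kx le_yi Hk]]].
  by exists 1; split=> // -[|[|j]].
exists k.+1; split=> //; first by rewrite expgS permM.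
move=> [|[|j]] //.
by move=> /= Hj; rewrite expgS permM; apply: Hk.
Qed.

Lemma Bcode_first_return n (s : 'S_n) i y :
  first_return (s^-1)%g i i y -> Bcode s i = y.+1.
Proof.
case/first_returnP => k [k0 kx le_yi Hk]; rewrite ffunE /Bexp.
case: ex_minnP => m /andP[m0 le_mi] min_m; congr (nat_of_ord _).+1.
suff -> : m = k by rewrite -kx expVgn.
apply/eqP; rewrite eqn_leq min_m ?k0 /=; last by rewrite -expVgn kx.
rewrite leqNgt; apply/negP => lt_mk.
by have := Hk m; rewrite m0 lt_mk expVgn ltnNge le_mi => /(_ isT).
Qed.

Lemma first_return_tperm n (t : 'S_n) (a m i x y : 'I_n) :
  (forall z : 'I_n, m <= z -> t z = z) -> i < m -> x < m ->
  first_return t i x y -> first_return (t * tperm a m)%g i x y.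
Proof.
move=> tfix lt_im lt_xm ret; elim: ret lt_xm => {x y} [x le_i | x y lt_i _ IH] lt_xm;
  have lt_txm : t x < m by rewrite ltnNge; apply/negP => le_m;
    move: (le_m); rewrite (perm_inj (tfix _ le_m)) leqNgt lt_xm.
all: have nm : t x != m by apply: contraTneq lt_txm => ->; rewrite ltnn.
all: have tm : t m = m by apply: tfix.
- have [eq_a|neq_a] := eqVneq (t x) a.
    have e : (t * tperm a m)%g x = m by rewrite permM eq_a tpermL.
    apply: FirstReturnStep; rewrite e //.
    have -> : t x = (t * tperm a m)%g m by rewrite permM tm tpermR.
    by apply: FirstReturnHit; rewrite permM tm tpermR -eq_a.
  have e : (t * tperm a m)%g x = t x by rewrite permM tpermD // eq_sym.
  by apply: first_return_hit e _.
- have [eq_a|neq_a] := eqVneq (t x) a.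
    have e : (t * tperm a m)%g x = m by rewrite permM eq_a tpermL.
    have e' : (t * tperm a m)%g m = t x by rewrite permM tm tpermR eq_a.
    apply: FirstReturnStep; rewrite e //.
    by apply: FirstReturnStep; rewrite e' //; apply: IH.
  have e : (t * tperm a m)%g x = t x by rewrite permM tpermD // eq_sym.
  by apply: FirstReturnStep; rewrite e //; apply: IH.
Qed.

Lemma tperm_prod_fix n (d : seq ('I_n * 'I_n)) (m : nat) (z : 'I_n) :
  all (fun p : 'I_n * 'I_n => p.1 <= p.2) d ->
  all (fun p : 'I_n * 'I_n => p.2 < m) d -> m <= z -> tperm_prod d z = z.
Proof.
move=> + + le_mz; elim: d => [|p d IHd] /=; first by rewrite perm1.
move=> /andP[le_p le_d] /andP[lt_p lt_d].
rewrite permM IHd // tpermD //; apply: contraTneq le_mz => <-; rewrite -ltnNge //.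
exact: leq_ltn_trans lt_p.
Qed.

Lemma first_return_tperm_prod n (d : seq ('I_n * 'I_n)) (i : 'I_n) :
  sorted (fun p q : 'I_n * 'I_n => p.2 < q.2) d ->
  all (fun p : 'I_n * 'I_n => p.1 <= p.2) d ->
  (forall a, (a, i) \in d -> first_return (tperm_prod d)^-1%g i i a) /\
  (i \notin [seq p.2 | p <- d] -> first_return (tperm_prod d)^-1%g i i i).
Proof.
elim/last_ind: d => [|d [a m] IHd].
  move=> _ _; split=> // _; have e : ((1 : 'S_n)^-1)%g i = i by rewrite invg1 perm1.
  by apply: first_return_hit e _.
rewrite sorted_rcons_snd all_rcons => /andP[srt lt_d] /andP[/= le_am le_d].
have [IH1 IH2] := IHd srt le_d.
rewrite tperm_prod_rcons invMg tpermV /=.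
have dfix (z : 'I_n) : m <= z -> (tperm_prod d)^-1%g z = z.
  by move=> le_mz; apply: (canLR (permK _)); rewrite (tperm_prod_fix le_d lt_d).
have [lt_im|lt_mi|/val_inj eq_im] := ltngtP i m.
- split=> [b | ]; rewrite ?map_rcons mem_rcons inE.
    case/predU1P=> [[_ eq_im]|/IH1]; first by rewrite eq_im ltnn in lt_im.
    exact: first_return_tperm.
  by rewrite negb_or => /andP[_ /IH2]; apply: first_return_tperm.
- have e : ((tperm_prod d)^-1 * tperm a m)%g i = i.
    rewrite permM dfix ?tpermD //; last exact: ltnW.
    + by apply: contraTneq lt_mi => <-; rewrite -leqNgt.
    + by apply: contraTneq lt_mi => <-; rewrite -leqNgt.
  split=> [b | _]; last by apply: first_return_hit e _.
  rewrite mem_rcons inE => /predU1P[[_ eq_im]|/(allP lt_d) /= lt_im].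
    by rewrite eq_im ltnn in lt_mi.
  by rewrite ltnNge ltnW in lt_im.
- have e : ((tperm_prod d)^-1 * tperm a m)%g i = a.
    by rewrite permM eq_im dfix ?tpermR.
  split=> [b | ]; rewrite ?map_rcons mem_rcons inE.
    case/predU1P=> [[-> _]|/(allP lt_d) /= ].
      by apply: first_return_hit e _; rewrite eq_im.
    by rewrite eq_im ltnn.
  by rewrite eq_im eqxx.
Qed.

Lemma sorting_decomp_mem n (s : 'S_n) d (p : 'I_n * 'I_n) :
  sorting_decomp s d ->
  (p \in d) = (p.1 < p.2) && (Bcode s p.2 == p.1.+1).
Proof.
case/and3P=> srt lt_d /eqP ->; case: p => a i /=.
have le_d : all (fun p : 'I_n * 'I_n => p.1 <= p.2) d.
  by apply: sub_all lt_d => p; apply: ltnW.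
have [H1 H2] := first_return_tperm_prod i srt le_d.
apply/idP/andP=> [ai_d | [lt_ai /eqP Bi]].
  split; first exact: (allP lt_d _ ai_d).
  by apply/eqP/Bcode_first_return/H1.
have [/mapP[[b j] bj_d /= eq_ij]|/H2 /Bcode_first_return] := boolP (i \in [seq p.2 | p <- d]).
  move: bj_d; rewrite -eq_ij => bi_d.
  have := Bcode_first_return (H1 _ bi_d); rewrite Bi => -[/val_inj ->] //.
by rewrite Bi => -[e]; rewrite e ltnn in lt_ai.
Qed.

Lemma sorting_decomp_inj n (s s' : 'S_n) d d' : Bcode s = Bcode s' ->
  sorting_decomp s d -> sorting_decomp s' d' -> d = d'.
Proof.
move=> eqB Hd Hd'.
have tr : transitive (fun p q : 'I_n * 'I_n => p.2 < q.2).
  by move=> b a c; apply: ltn_trans.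
have ir : irreflexive (fun p q : 'I_n * 'I_n => p.2 < q.2).
  by move=> p /=; rewrite ltnn.
apply: (irr_sorted_eq tr ir); [by case/and3P: Hd | by case/and3P: Hd' |].
by move=> p; rewrite (sorting_decomp_mem p Hd) (sorting_decomp_mem p Hd') eqB.
Qed.

Lemma sorting_decomp_uniq n (s : 'S_n) d d' :
  sorting_decomp s d -> sorting_decomp s d' -> d = d'.
Proof. exact: sorting_decomp_inj. Qed.

Lemma Bcode_inj n : injective (@Bcode n).
Proof.
move=> s s' eqB; have [d Hd] := sorting_decomp_exists s.
have [d' Hd'] := sorting_decomp_exists s'.
have eq_d := sorting_decomp_inj eqB Hd Hd'.
by case/and3P: Hd => _ _ /eqP ->; case/and3P: Hd' => _ _ /eqP ->; rewrite eq_d.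
Qed.

Lemma Bcode_is_code n (s : 'S_n) : is_code (Bcode s).
Proof.
apply/forallP => i; rewrite ffunE /Bexp /=.
by case: ex_minnP => k /andP[].
Qed.

Lemma Bcode_surj n (l : code n) : is_code l -> exists s : 'S_n, Bcode s == l.
Proof.
move/forallP => code_l.
have lt_l (j : 'I_n) : (l j).-1 < n.
  case/andP: (code_l j) => l0 le_l.
  by rewrite prednK // (leq_trans le_l).
pose d := [seq (Ordinal (lt_l j), j) | j <- enum 'I_n].
exists (tperm_prod d); apply/eqP/ffunP => i.
have srt : sorted (fun p q : 'I_n * 'I_n => p.2 < q.2) d.
  have := iota_ltn_sorted 0 n; rewrite -val_enum_ord sorted_map.
  by rewrite /d sorted_map.
have le_d : all (fun p : 'I_n * 'I_n => p.1 <= p.2) d.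
  apply/allP => _ /mapP[j _ ->] /=; case/andP: (code_l j) => l0 le_l.
  by rewrite -ltnS prednK.
have [H1 _] := first_return_tperm_prod i srt le_d.
rewrite (@Bcode_first_return _ _ _ (Ordinal (lt_l i))) /=.
  by rewrite prednK //; case/andP: (code_l i).
by apply: H1; apply/mapP; exists i; rewrite ?mem_enum.
Qed.

Definition Bcode_inv n (l : code n) (code_l : is_code l) : 'S_n :=
  xchoose (Bcode_surj code_l).

Lemma Leh_is_code n (s : 'S_n) : is_code (Leh s).
Proof.
apply/forallP => i; rewrite ffunE; apply/andP; split.
  by apply/card_gt0P; exists i; rewrite inE !leqnn.
rewrite -[leqRHS]card_ord.
apply: leq_trans (leq_imset_card (widen_ord (ltn_ord i)) _).
apply/subset_leq_card/subsetP => j; rewrite inE => /andP[le_ji _].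
by apply/imsetP; exists (Ordinal (le_ji : j < i.+1)) => //; apply: val_inj.
Qed.

Lemma Acode_is_code n (s : 'S_n) : is_code (Acode s).
Proof. exact: Leh_is_code. Qed.

Definition phi n (s : 'S_n) : 'S_n := Bcode_inv (Acode_is_code s).

Lemma phiE n (s : 'S_n) : Bcode (phi s) = Acode s.
Proof. exact/eqP/(xchooseP (Bcode_surj _)). Qed.

Definition qnum (R : comNzRingType) (q : R) (r : nat) : R :=
  (\sum_(0 <= i < r) q ^+ i)%R.

(* Main.v *)
Require Import Defs.
From mathcomp Require Import all_boot all_order all_algebra all_fingroup.
From mathcomp Require Import ring.

(** Each of the set-valued statistics is read off a code by a rule that does
    not depend on the permutation: with [l = A(s)] or [l = B(s)] respectively,
    - [Inv] and [Sor] are the induced set of [l];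
    - [Rmil] and [Cyc] are the indices [v] with [l_v = v];
    - [Lmil] and [Lmic1] are the indices [v] with [l_v = 1];
    - [Lmap] is, for both codes, the set of strict right-to-left minimal values
      of [l].
    Since [B (phi s) = A s], the quadruples agree.  Moreover [inv] and [sor] are
    both the sum of the [i - l_i], so the generating function factors over the
    entries of the code, which vary independently. *)

Set Implicit Arguments.
Unset Strict Implicit.
Unset Printing Implicit Defensive.

(** * Counting and ranks in ['I_n] *)

Lemma card_ord_le n (k : 'I_n) : #|[set x : 'I_n | x <= k]| = k.+1.
Proof.
rewrite -[RHS]card_ord -!sum1_card (big_ord_widen n (fun=> 1)) ?ltn_ord //.
by apply: eq_bigl => x; rewrite inE ltnS.
Qed.

Lemma card_perm_le n (s : 'S_n) (k : 'I_n) : #|[set x : 'I_n | s x <= k]| = k.+1.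
Proof.
rewrite -[RHS](card_ord_le k) -[RHS](card_preimset _ (@perm_inj _ s)).
by apply: eq_card => x; rewrite !inE.
Qed.

Lemma sorted_enum_set n (S : {set 'I_n}) :
  sorted (fun i j : 'I_n => i < j) (enum S).
Proof.
have -> : enum S = [seq x <- enum 'I_n | x \in S].
  by rewrite {1}/enum_mem -enumT; apply: eq_filter.
apply: sorted_filter; first by move=> b a c; apply: ltn_trans.
by have := iota_ltn_sorted 0 n; rewrite -val_enum_ord sorted_map.
Qed.

Lemma count_le_sorted n (r : seq 'I_n) (x : 'I_n) :
  sorted (fun i j : 'I_n => i < j) r -> x \in r ->
  count (fun y : 'I_n => y <= x) r = (index x r).+1.
Proof.
have tr : transitive (fun i j : 'I_n => i < j) by move=> b a c; apply: ltn_trans.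
elim: r => //= a r IHr; rewrite (path_sortedE tr) => /andP[/allP lt_a srt].
rewrite inE; have [-> _ | neq_xa /= x_r] := eqVneq x a.
  rewrite leqnn (@eq_in_count _ _ pred0) ?count_pred0 // => y /lt_a lt_ay.
  by apply/negbTE; rewrite -ltnNge.
by rewrite (ltnW (lt_a _ x_r)) (IHr srt x_r).
Qed.

Lemma kth_smallest_rank n (x0 x : 'I_n) (S : {set 'I_n}) : x \in S ->
  kth_smallest x0 S #|[set y in S | y <= x]| = x.
Proof.
move=> xS; rewrite /kth_smallest.
have -> : #|[set y in S | y <= x]| = (index x (enum S)).+1.
  rewrite -count_le_sorted ?mem_enum ?sorted_enum_set //.
  rewrite cardE -size_filter {1 2}/enum_mem -filter_predI.
  by congr size; apply: eq_filter => y; rewrite !inE andbC.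
by rewrite nth_index ?mem_enum.
Qed.

(** * The A-code *)

(** Evaluating at [s k] removes the inverse permutation from the count, so the proofs about the
    A-code first replace [v] by [s k]. *)
Lemma AcodeE n (s : 'S_n) (k : 'I_n) :
  Acode s (s k) = #|[set x : 'I_n | (s x <= s k) && (x <= k)]|.
Proof.
rewrite ffunE permK -(card_preimset _ (@perm_inj _ s)).
by apply: eq_card => x; rewrite !inE permK.
Qed.

(** Loop invariant once the indices [i >= m] are processed. The entry at [s k0] is the rank of [k0]
    among the positions of value at most [s k0], which are those still present; hence [k0] is
    removed and the pairs added are its inversions. *)
Lemma induced_Acode_drop n (s : 'S_n) (m : nat) : m <= n ->
  foldr (induced_step (Acode s)) (setT, set0) (drop m (enum 'I_n)) =
  ([set x : 'I_n | s x < m], [set p in Inv s | m <= s p.1]).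
Proof.
(* Downward induction on [m], run as induction on [n - m]. *)
move=> le_mn; rewrite -(subKn le_mn); have := leq_subr m n.
elim: (n - m) => [|k IHk] lt_kn.
  rewrite subn0 drop_oversize ?size_enum_ord //=; congr pair; apply/setP => x.
    by rewrite !inE ltn_ord.
  by rewrite !inE [n <= _]leqNgt ltn_ord andbF.
set i := n - k.+1 in IHk *.
have lt_in : i < n by rewrite /i ltn_subrL (leq_trans _ lt_kn).
have eq_i : n - k = i.+1 by rewrite /i subnSK.
rewrite (drop_nth (Ordinal lt_in)) ?size_enum_ord //= -eq_i IHk ?(ltnW lt_kn) //.
have -> : nth (Ordinal lt_in) (enum 'I_n) i = Ordinal lt_in.
  exact: (nth_ord_enum _ (Ordinal lt_in)).
move: (Ordinal lt_in) (erefl : val (Ordinal lt_in) = i) => v def_v.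
rewrite eq_i -def_v {IHk eq_i lt_in lt_kn def_v i}.
rewrite -(permKV s v); move: ((s^-1)%g v) => {}k0; rewrite /induced_step /=.
have -> : kth_smallest (s k0) [set x : 'I_n | s x < (s k0).+1] (Acode s (s k0)) = k0.
  rewrite AcodeE -[RHS](@kth_smallest_rank _ (s k0) k0 [set x : 'I_n | s x < (s k0).+1]) ?inE //.
  by congr kth_smallest; apply: eq_card => x; rewrite !inE.
congr pair; apply/setP.
  by move=> x; rewrite !inE ltnS [RHS]ltn_neqAle (inj_eq val_inj) (inj_eq perm_inj).
move=> [a b]; rewrite !inE /= [s k0 <= s a]leq_eqVlt.
have -> : ((a, b) \in [set (k0, j) | j in [set x : 'I_n | s x < (s k0).+1] & k0 < j]) =
          [&& a == k0, s b <= s k0 & k0 < b].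
  apply/imsetP/and3P => [[j] | [/eqP -> le_b lt_b]].
    by rewrite !inE ltnS => /andP[? ?] [-> ->].
  by exists b; rewrite ?inE ?ltnS ?le_b.
rewrite [RHS]andb_orr orbC; congr orb.
rewrite (inj_eq val_inj) (inj_eq perm_inj) [k0 == a]eq_sym.
have [->|_] := eqVneq a k0; last by rewrite andbF.
rewrite andbT /= andbC; have [lt_b /=|//] := boolP (k0 < b).
rewrite leq_eqVlt (inj_eq val_inj) (inj_eq perm_inj).
by case: eqVneq lt_b => // ->; rewrite ltnn.
Qed.

Lemma induced_Acode n (s : 'S_n) : induced (Acode s) = Inv s.
Proof.
rewrite /induced -[enum _]drop0 induced_Acode_drop //=.
by apply/setP => p; rewrite !inE andbT.
Qed.

(** The count in [AcodeE] runs over a subset of the [(s k).+1] positions of value at most [s k]; it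
    is full exactly when none of them lies to the right of [k]. *)
Lemma Rmil_Acode n (s : 'S_n) : Rmil s = [set v : 'I_n | Acode s v == v.+1].
Proof.
apply/setP => v; rewrite -(permKV s v); move: ((s^-1)%g v) => {v}k.
rewrite mem_imset; last exact: perm_inj.
rewrite !inE AcodeE -[X in _ == X](card_perm_le s (s k)).
have sub : [set x : 'I_n | (s x <= s k) && (x <= k)] \subset [set x : 'I_n | s x <= s k].
  by apply/subsetP => x; rewrite !inE => /andP[].
rewrite (subset_leqif_cards sub); apply/forallP/eqP => [H | /setP E j].
  apply/setP => x; rewrite !inE andb_idr // => le_x; rewrite leqNgt.
  by apply: contraL le_x => /(implyP (H x)); rewrite -ltnNge.
apply/implyP => lt_kj; rewrite ltnNge; apply: contraL lt_kj => le_j.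
by have := E j; rewrite !inE le_j /= -leqNgt => ->.
Qed.

(** Position [k] is always counted; any other counted position carries a smaller value to its
    left. *)
Lemma Lmil_Acode n (s : 'S_n) : Lmil s = ones (Acode s).
Proof.
apply/setP => v; rewrite -(permKV s v); move: ((s^-1)%g v) => {v}k.
rewrite mem_imset; last exact: perm_inj.
rewrite !inE AcodeE -(cards1 k) eq_sym.
have sub : [set k] \subset [set x : 'I_n | (s x <= s k) && (x <= k)].
  by rewrite sub1set inE !leqnn.
rewrite (subset_leqif_cards sub); apply/forallP/eqP => [H | /setP E j].
  apply/setP => x; rewrite !inE; apply/eqP/andP => [-> // | [le_x]].
  rewrite leq_eqVlt => /predU1P[/val_inj // | /(implyP (H x))].
  by rewrite ltnNge le_x.
apply/implyP => lt_jk; rewrite ltnNge; apply/negP => le_j.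
have := E j; rewrite !inE le_j (ltnW lt_jk) => /eqP ejk.
by rewrite ejk ltnn in lt_jk.
Qed.

(* The strict right-to-left minimal values of a code, shifted to ['I_n]. *)
Definition rl_min_values n (l : code n) : {set 'I_n} :=
  [set k : 'I_n | [exists v : 'I_n,
     (l v == k.+1) && [forall u : 'I_n, (v < u) ==> (k.+1 < l u)]]].

(** A left-to-right maximum [i] is witnessed by the value [s i], whose entry counts all positions up
    to [i]. A larger value sits to the right of [i], so its entry counts these and its own
    position. *)
Lemma Lmap_Acode n (s : 'S_n) : Lmap s = rl_min_values (Acode s).
Proof.
apply/setP => i; rewrite !inE; apply/forallP/existsP => [H | [v /andP[/eqP lv /forallP Hu]]].
  have sub : [set x : 'I_n | x <= i] \subset [set x : 'I_n | s x <= s i].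
    apply/subsetP => x; rewrite !inE leq_eqVlt => /predU1P[/val_inj -> // |].
    by move/(implyP (H x))/ltnW.
  exists (s i); apply/andP; split.
    rewrite AcodeE -(card_ord_le i); apply/eqP/eq_card => x; rewrite !inE andb_idl //.
    by move: (subsetP sub x); rewrite !inE.
  apply/forallP => u; apply/implyP; rewrite -(permKV s u); move: ((s^-1)%g u) => {u}k lt_ik.
  have lt_k : i < k.
    by rewrite ltnNge; apply: contraL lt_ik => le_ki;
      have := subsetP sub k; rewrite !inE -leqNgt; apply.
  rewrite AcodeE -(card_ord_le i); apply: proper_card; apply/properP; split.
    apply/subsetP => x xi; have := subsetP sub x xi; rewrite !inE in xi * => le_x.
    by rewrite (leq_trans le_x (ltnW lt_ik)) (leq_trans xi (ltnW lt_k)).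
  by exists k; rewrite !inE ?leqnn // -ltnNge.
move: lv Hu; rewrite -(permKV s v); move: ((s^-1)%g v) => {v}k lk Hu.
(* The entry at [s x] is at most [x.+1], which pushes every value above [s k] to the right of
   [i]. *)
have gt_i (x : 'I_n) : s k < s x -> i < x.
  move=> /(implyP (Hu (s x))); rewrite AcodeE => lt_i.
  rewrite -ltnS (leq_trans lt_i) // -(card_ord_le x).
  by apply/subset_leq_card/subsetP => y; rewrite !inE => /andP[].
have le_s (x : 'I_n) : x <= i -> s x <= s k.
  by move=> le_x; rewrite leqNgt; apply: contraL le_x => /gt_i; rewrite -ltnNge.
have le_ik : i <= k.
  rewrite -ltnS -lk AcodeE -(card_ord_le k).
  by apply/subset_leq_card/subsetP => y; rewrite !inE => /andP[].
have eq_ik : i = k.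
  apply: val_inj; apply/eqP; rewrite eqn_leq le_ik /= leqNgt; apply/negP => lt_ik.
  suff : i.+1 < Acode s (s k) by rewrite lk ltnn.
  rewrite AcodeE -(card_ord_le i); apply: proper_card; apply/properP; split.
    by apply/subsetP => x; rewrite !inE => le_x; rewrite le_s // (leq_trans le_x).
  by exists k; rewrite !inE ?leqnn // -ltnNge.
move=> j; apply/implyP => lt_ji; rewrite ltn_neqAle {2}eq_ik (le_s _ (ltnW lt_ji)) andbT.
by rewrite (inj_eq val_inj) (inj_eq perm_inj); apply: contraTneq lt_ji => ->; rewrite ltnn.
Qed.

(** The summand at [s k] counts the smaller values to the right of [k]. *)
Lemma inv_stat_Acode n (s : 'S_n) : inv_stat s = \sum_(v < n) (v.+1 - Acode s v).
Proof.
rewrite (reindex_inj (@perm_inj _ s)) /= /inv_stat -sum1_card.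
transitivity (\sum_(i < n) \sum_(j < n | (i < j) && (s j < s i)) 1).
  by rewrite pair_big_dep; apply: eq_bigl => p; rewrite inE.
apply: eq_bigr => k _; rewrite sum1_card AcodeE -(card_perm_le s (s k)).
rewrite -(cardsID [set x : 'I_n | x <= k]).
set A := _ :&: _; set B := _ :\: _.
have -> : #|A| = #|[set x : 'I_n | (s x <= s k) && (x <= k)]|.
  by apply: eq_card => x; rewrite !inE.
rewrite addKn; apply: eq_card => x; rewrite !inE -ltnNge.
rewrite -topredE /=; have [lt_kx|//] := boolP (k < x); rewrite /= ltn_neqAle.
by rewrite (inj_eq val_inj) (inj_eq perm_inj); case: eqVneq lt_kx => // ->; rewrite ltnn.
Qed.

(** * The B-code *)

Lemma BcodeP n (s : 'S_n) (i : 'I_n) : exists k (b : 'I_n),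
  [/\ 0 < k, (s ^- k)%g i = b, Bcode s i = b.+1, b <= i &
      forall j, 0 < j < k -> i < (s ^- j)%g i].
Proof.
rewrite ffunE /Bexp; case: ex_minnP => k /andP[k0 le_k] min_k.
exists k, ((s ^- k)%g i); split=> // j.
case/andP=> j0 lt_jk; rewrite ltnNge; apply: contraL lt_jk => le_j.
by rewrite -leqNgt min_k ?j0.
Qed.

Lemma Bcode_image n (s : 'S_n) (i : 'I_n) : i <= s i -> Bcode s (s i) = i.+1.
Proof.
by move=> le_i; apply/Bcode_first_return/first_return_hit => //; rewrite permK.
Qed.

(** Going backwards from [v], the point visited just before the first return [i] is [s i]: it is [v]
    itself or still exceeds [v]. *)
Lemma Bcode_le_image n (s : 'S_n) (v i : 'I_n) : Bcode s v = i.+1 -> v <= s i.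
Proof.
have [[|[|k]] [b [// _ <- -> _ lt_v]]] := BcodeP s v => -[/val_inj <-].
  by rewrite expg1 permKV.
by rewrite -expVgn expgSr permM permKV expVgn ltnW ?lt_v /=.
Qed.

Lemma Cyc_Bcode n (s : 'S_n) : Cyc s = [set v : 'I_n | Bcode s v == v.+1].
Proof.
apply/setP => v; rewrite !inE; have [k [b [k0 def_b -> le_v lt_v]]] := BcodeP s v.
rewrite eqSS (inj_eq val_inj); apply/forallP/eqP => [H | Bv j].
  apply/val_inj/eqP; rewrite eqn_leq le_v (implyP (H _)) // -def_b -expVgn.
  by rewrite -porbitV mem_porbit.
apply/implyP; rewrite -porbitV => /porbitP[m ->].
(* When the first return is to [v] itself, exponents reduce modulo [k], and nonzero remainders stay
   above [v] by minimality of [k]. *)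
have -> : (s^-1 ^+ m)%g v = (s ^- (m %% k))%g v.
  rewrite {1}(divn_eq m k) expgD permM -expVgn; congr (fun_of_perm _ _).
  elim: (m %/ k) => [|d IHd]; first by rewrite perm1.
  by rewrite mulSn expgD permM (expVgn s k) def_b Bv.
have [-> | m0] := posnP (m %% k); first by rewrite invg1 perm1.
by rewrite ltnW // lt_v // m0 ltn_mod.
Qed.

Lemma Lmap_Bcode n (s : 'S_n) : Lmap s = rl_min_values (Bcode s).
Proof.
apply/setP => i; rewrite !inE; apply/forallP/existsP => [H | [v /andP[/eqP bv /forallP Hu]]].
  have le_s (x : 'I_n) : x <= i -> s x <= s i.
    by rewrite leq_eqVlt => /predU1P[/val_inj -> // | /(implyP (H x))/ltnW].
  (* The [i.+1] positions up to [i] all have values at most [s i]. *)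
  have le_i : i <= s i.
    rewrite -ltnS -(card_ord_le i) -(card_perm_le s (s i)).
    by apply/subset_leq_card/subsetP => x; rewrite !inE; apply: le_s.
  exists (s i); rewrite Bcode_image // eqxx; apply/forallP => u; apply/implyP => lt_u.
  have [_ [j [_ _ Bu _ _]]] := BcodeP s u; have le_u := Bcode_le_image Bu.
  rewrite Bu ltnS ltnNge; apply/negP => /le_s.
  by move/(leq_trans le_u); rewrite leqNgt lt_u.
have le_v := Bcode_le_image bv.
have le_iv : i <= v.
  by have [_ [b [_ _ Bv le_b _]]] := BcodeP s v; move: bv; rewrite Bv => -[<-].
(* Otherwise [s i] lies above [v] and has the same entry [i.+1], against strict minimality at
   [v]. *)
have sv : s i = v.
  apply/val_inj/eqP; rewrite eqn_leq le_v andbT leqNgt; apply/negP.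
  by move/(implyP (Hu _)); rewrite Bcode_image ?ltnn // (leq_trans le_iv).
move=> j; apply/implyP => lt_ji; rewrite sv ltn_neqAle -{1}sv.
rewrite (inj_eq val_inj) (inj_eq perm_inj) -val_eqE /= ltn_eqF // leqNgt.
apply/negP => lt_v; have := implyP (Hu _) lt_v; rewrite Bcode_image.
  by rewrite ltnS ltnNge ltnW.
by rewrite ltnW // (leq_trans lt_ji) // (leq_trans le_iv) // ltnW.
Qed.

Lemma sor_Bcode n (s : 'S_n) : sor s = \sum_(v < n) (v.+1 - Bcode s v).
Proof.
rewrite /sor; have := xchooseP (sorting_decomp_exists s).
move: (xchoose _) => d Hd.
have uniq_d : uniq d.
  case/and3P: Hd => srt _ _; apply: sorted_uniq srt.
    by move=> b a c; apply: ltn_trans.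
  by move=> p /=; rewrite ltnn.
rewrite big_uniq //= (eq_bigl _ _ (fun p => sorting_decomp_mem p Hd)).
(* Group the transpositions by larger element: [v] contributes [(b, v)] when its entry is [b.+1]
   with [b < v], and nothing when [b = v]. *)
rewrite (partition_big snd predT) //=.
apply: eq_bigr => v _; have [_ [b [_ _ Bv le_b _]]] := BcodeP s v; rewrite Bv subSS.
move: le_b; rewrite leq_eqVlt => /predU1P[/val_inj eq_b | lt_b].
  rewrite eq_b subnn big_pred0 // => -[a u] /=.
  by case: (eqVneq u v) => [->|_]; rewrite ?andbF // Bv eqSS eq_b; case: ltngtP.
rewrite (big_pred1 (b, v)) // => -[a u] /=; rewrite xpair_eqE.
case: (eqVneq u v) => [->|_]; rewrite ?andbF // !andbT Bv eqSS (inj_eq val_inj) eq_sym.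
by rewrite andb_idl // => /eqP ->.
Qed.

(** * Equidistribution *)

(** The value [s i] is recovered by counting the [x] with [s x <= s i], and inversions decide each
    of these comparisons. *)
Lemma Inv_inj n : injective (@Inv n).
Proof.
move=> s s' eqI; apply/permP => i; apply/val_inj/succn_inj.
rewrite -(card_perm_le s) -(card_perm_le s'); apply: eq_card => x; rewrite !inE.
have E (a b : 'I_n) : a < b -> (s b < s a) = (s' b < s' a).
  by move=> lt_ab; have /setP/(_ (a, b)) := eqI; rewrite !inE /= lt_ab.
have neq (t : 'S_n) : x != i -> (t x <= t i) = (t x < t i).
  by move=> neq_xi; rewrite leq_eqVlt (inj_eq val_inj) (inj_eq perm_inj) (negbTE neq_xi).
have [-> | neq_xi] := eqVneq x i; first by rewrite !leqnn.
case: (ltngtP x i) => [lt_xi | lt_ix | /val_inj eq_xi].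
- by rewrite leqNgt E // -leqNgt.
- by rewrite !neq // E.
- by rewrite eq_xi eqxx in neq_xi.
Qed.

Lemma phi_stats n (s : 'S_n) :
  (Inv s, Rmil s, Lmap s, Lmil s) =
  (Sor (phi s), Cyc (phi s), Lmap (phi s), Lmic1 (phi s)).
Proof.
by rewrite /Sor /Lmic1 Cyc_Bcode (Lmap_Bcode (phi s)) phiE -Lmap_Acode -Rmil_Acode
  -Lmil_Acode induced_Acode.
Qed.

(** [Sor (phi s)] is [Inv s], which determines [s], so the A-code need not be inverted. As ['S_n] is
    finite, injectivity suffices to reindex along [phi]. *)
Lemma phi_inj n : injective (@phi n).
Proof.
by move=> s s' eq_phi; apply: Inv_inj; have [-> _ _ _] := phi_stats s;
  have [-> _ _ _] := phi_stats s'; rewrite eq_phi.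
Qed.

Lemma phi_num_stats n (s : 'S_n) :
  [/\ inv_stat s = sor (phi s), rmin s = cyc (phi s), lmax s = lmax (phi s)
    & lmin s = lmic1 (phi s)].
Proof.
rewrite inv_stat_Acode sor_Bcode phiE /rmin /cyc /lmax /lmin /lmic1.
by have [_ -> -> ->] := phi_stats s.
Qed.

(** * The generating function *)

(** The 0-based B-code with entries in ['I_n]: such functions form a finite type, over which a
    product of sums can be expanded. *)
Definition Bord n (s : 'S_n) : {ffun 'I_n -> 'I_n} :=
  [ffun i => (s ^- Bexp s i)%g i].

Lemma BordE n (s : 'S_n) i : Bcode s i = (Bord s i).+1.
Proof. by rewrite !ffunE. Qed.

Lemma Bord_inj n : injective (@Bord n).
Proof. by move=> s s' E; apply: Bcode_inj; apply/ffunP => i; rewrite !BordE E. Qed.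

(** Surjectivity of the B-code in the form that distributivity uses: the entries vary
    independently. *)
Lemma Bord_image n :
  @Bord n @: setT = [set f in family (fun i : 'I_n => [pred j : 'I_n | j <= i])].
Proof.
apply/setP => f; rewrite inE; apply/imsetP/familyP => [[s _ -> i] | H].
  by have /forallP/(_ i) := Bcode_is_code s; rewrite BordE inE.
have Hl : is_code [ffun i => (f i).+1 : nat].
  by apply/forallP => i; rewrite ffunE; have := H i; rewrite inE.
have [s /eqP Bs] := Bcode_surj Hl; exists s => //.
by apply/ffunP => i; apply/val_inj/succn_inj; rewrite -BordE Bs ffunE.
Qed.

Section GeneratingFunction.

Import GRing.Theory.
Local Open Scope ring_scope.

Variables (R : comNzRingType) (q x y : R).

Lemma expr_card_set (z : R) (I : finType) (P : pred I) :
  z ^+ #|[set i | P i]| = \prod_i z ^+ P i.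
Proof.
rewrite prodrXr -sum1_card big_mkcond; congr (z ^+ _).
by apply: eq_bigr => i _; rewrite inE; case: (P i).
Qed.

Lemma sum_Bcode_weight n :
  \sum_(s : 'S_n) q ^+ sor s * x ^+ cyc s * y ^+ lmic1 s =
  \prod_(i < n) \sum_(j < i.+1)
     q ^+ (i - j) * x ^+ (j == i :> nat) * y ^+ (j == 0 :> nat).
Proof.
pose G (i j : nat) := q ^+ (i - j) * x ^+ (j == i :> nat) * y ^+ (j == 0 :> nat).
(* Distributivity wants all inner sums over the same type ['I_n], so the bound on [j] becomes a
   condition. *)
transitivity (\prod_(i < n) \sum_(j < n | (j <= i)%N) G i j); last first.
  apply: eq_bigr => i _.
  by rewrite (big_ord_widen_cond n xpredT (G i)) ?ltn_ord.
rewrite bigA_distr_big_dep /=.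
rewrite (eq_bigl (fun f => f \in @Bord n @: setT)); last first.
  by move=> f; rewrite Bord_image inE.
rewrite big_imset /=; last by move=> s s' _ _; apply: Bord_inj.
apply: eq_big => [s | s _]; first by rewrite inE.
rewrite sor_Bcode /cyc Cyc_Bcode /lmic1 /Lmic1 /ones !expr_card_set -prodrXr.
rewrite -!big_split; apply: eq_bigr => i _ /=.
by rewrite BordE subSS !eqSS.
Qed.

(** The last and first terms are [x] and [y * q ^+ m.+1]; the others form [qnum q m.+2] without its
    end terms [1] and [q ^+ m.+1]. *)
Lemma sum_code_entry m :
  \sum_(j < m.+2) q ^+ (m.+1 - j) * x ^+ (j == m.+1 :> nat) * y ^+ (j == 0 :> nat) =
  x + qnum q m.+2 + y * q ^+ m.+1 - 1 - q ^+ m.+1.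
Proof.
rewrite big_ord_recl big_ord_recr /= /qnum big_mkord big_ord_recl big_ord_recr /=.
rewrite /bump /= !add1n eqxx subnn.
set S1 := \sum_(_ < _) _; set S2 := \sum_(_ < _) _.
have -> : S1 = S2.
  (* The inner powers of [q] appear in decreasing order in [S1] and increasing in [S2]. *)
  rewrite /S1 (reindex_inj rev_ord_inj); apply: eq_bigr => j _ /=.
  rewrite /bump /= !add1n eqSS ltn_eqF; last by rewrite ltn_subrL (leq_ltn_trans _ (ltn_ord j)).
  by rewrite subSS subnA ?subnn // ?expr0 ?mulr1.
by rewrite !expr0 !expr1; ring.
Qed.

Lemma sum_Bcode_product n : (0 < n)%N ->
  \sum_(s : 'S_n) q ^+ sor s * x ^+ cyc s * y ^+ lmic1 s =
  x * y * \prod_(2 <= r < n.+1) (x + qnum q r + y * q ^+ r.-1 - 1 - q ^+ r.-1).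
Proof.
(* The first entry is forced and is both minimal and maximal, whence the factor [x * y]. *)
case: n => // n _; rewrite sum_Bcode_weight big_ord_recl big_ord1 /=.
rewrite expr0 mul1r !expr1; congr (_ * _).
rewrite !big_add1 big_mkord; apply: eq_bigr => i _.
exact: sum_code_entry.
Qed.

End GeneratingFunction.

Theorem theorem1p3 (n : nat) (hn : 1 <= n) :
  (forall s : 'S_n,
     (Inv s, Rmil s, Lmap s, Lmil s) =
     (Sor (phi s), Cyc (phi s), Lmap (phi s), Lmic1 (phi s))) /\
  ((forall a b c d : nat,
      #|[set s : 'S_n | (inv_stat s, rmin s, lmax s, lmin s) == (a, b, c, d)]| =
      #|[set s : 'S_n | (sor s, cyc s, lmax s, lmic1 s) == (a, b, c, d)]|) /\
   (forall (R : comNzRingType) (q x y : R),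
      (\sum_(s : 'S_n) q ^+ inv_stat s * x ^+ rmin s * y ^+ lmin s =
       \sum_(s : 'S_n) q ^+ sor s * x ^+ cyc s * y ^+ lmic1 s)%R /\
      (\sum_(s : 'S_n) q ^+ sor s * x ^+ cyc s * y ^+ lmic1 s =
       x * y * \prod_(2 <= r < n.+1)
                 (x + qnum q r + y * q ^+ r.-1 - 1 - q ^+ r.-1))%R)).
Proof.
split; first exact: phi_stats.
split=> [a b c d | R q x y].
  rewrite -[RHS](card_preimset _ (@phi_inj n)); apply: eq_card => s.
  by rewrite !inE; have [-> -> -> ->] := phi_num_stats s.
split; last exact: sum_Bcode_product.
rewrite [RHS](reindex_inj (@phi_inj n)); apply: eq_bigr => s _.
by have [-> -> _ ->] := phi_num_stats s.
Qed.
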